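(* Assume that $\Gamma(X)^T\Gamma(X)$ is almost surely invertible. Let $a=(a_j)_{j=1}^n\in\mathbb{R}^n$ and $m\le Cn$ for some constant $C$. Assume that $\rho(a)\in L^p(\Omega)$ and $K_q(\Gamma)<+\infty$ for some $p\in[1,+\infty]$ and with $q^{-1}+p^{-1}=1$. Then there exists a constant $C(n)$, depending on $n$ (and on $C$ and $K_q(\Gamma)$) but not on $f$ or $a$, such that $$\mathbb{E}\,\|\beta-a\|_2\le C(n)\,\|\rho(a)\|_{L^p(\Omega)}.$$
   Context: $(\Omega,\mu)$ is a probability space, $n,m\ge1$ are integers, and $f,\gamma_1,\dots,\gamma_n:\Omega\to\mathbb{R}$ are measurable functions. For $a\in\mathbb{R}^n$ the residue is $\rho(a)(x)=f(x)-\sum_{j=1}^n a_j\gamma_j(x)$. $X=(X^{(1)},\dots,X^{(m)})$ where $X^{(1)},\dots,X^{(m)}$ are i.i.d. random points of $\Omega$ with distribution $\mu$. $F(X)=(f(X^{(1)}),\dots,f(X^{(m)}))^T\in\mathbb{R}^m$, and $\Gamma(X)$ is the random $m\times n$ matrix with entries $\Gamma_{ij}(X)=\gamma_j(X^{(i)})$. The random vector $\beta\in\mathbb{R}^n$ is $\beta=(\Gamma(X)^T\Gamma(X))^{-1}\Gamma(X)^TF(X)$. $s_1(\Gamma(X))$ is the smallest eigenvalue of $\Gamma(X)^T\Gamma(X)$. For $q\in[1,\infty)$, $K_q(\Gamma)=\big[\mathbb{E}\,(s_1(\Gamma(X))^{-q/2})\big]^{2/q}$, and $K_\infty(\Gamma)=\|s_1(\Gamma(X))^{-1}\|_{L^\infty}$.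 $\|\cdot\|_2$ is the Euclidean norm. *)

(* Defs.v *)
From HB Require Import structures.
From mathcomp Require Import all_boot all_order all_algebra.
From mathcomp Require Import all_classical all_reals all_analysis.

Set Implicit Arguments.
Unset Strict Implicit.
Unset Printing Implicit Defensive.
Import Order.TTheory GRing.Theory Num.Theory.
Import numFieldNormedType.Exports.

Local Open Scope classical_set_scope.
Local Open Scope ring_scope.

(* The library's norm on matrices is the sup norm. *)
Definition euclidean_norm (R : realType) (n : nat) (v : 'cV[R]_n) : R :=
  Num.sqrt (\sum_(i < n) v i 0 ^+ 2).

(* For a symmetric [A] and [0 < n] the set of eigenvalues is finite and
   nonempty, so that the infimum is a minimum. *)
Definition smallest_eigenvalue (R : realType) (n : nat) (A : 'M[R]_n) : R :=
  inf [set l : R | eigenvalue A l].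

(* The sample space [T] of the random points is arbitrary. The law of each
   [X i] is compared with [mu] on measurable sets only, because a measure is
   unconstrained on the other sets. *)
Definition iid (R : realType) (d d' : measure_display)
    (Omega : measurableType d) (mu : probability Omega R)
    (T : measurableType d') (P : probability T R)
    (m : nat) (X : 'I_m -> {RV P >-> Omega}) : Prop :=
  (forall (i : 'I_m) (A : set Omega),
     measurable A -> distribution P (X i) A = mu A) /\
  (forall (J : {set 'I_m}) (A : 'I_m -> set Omega),
     (forall i, measurable (A i)) ->
     P (\bigcap_(i in [set` J]) (X i @^-1` A i)) =
     (\prod_(i in J) P (X i @^-1` A i))%E).

Section LeastSquares.
Context {R : realType} {d : measure_display} {Omega : measurableType d}.
Context {n m : nat}.
Implicit Types (f : Omega -> R) (gamma : 'I_n -> Omega -> R) (a : 'cV[R]_n).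
Implicit Types x : 'I_m -> Omega.

Definition residue f gamma a (y : Omega) : R :=
  f y - \sum_(j < n) a j 0 * gamma j y.

Definition sample_vector f x : 'cV[R]_m := \col_(i < m) f (x i).

Definition sample_matrix gamma x : 'M[R]_(m, n) :=
  \matrix_(i < m, j < n) gamma j (x i).

Definition gram gamma x : 'M[R]_n :=
  (sample_matrix gamma x)^T *m sample_matrix gamma x.

(* [invmx] is the identity on singular matrices, so this is only meaningful
   where [gram gamma x] is invertible. *)
Definition least_squares f gamma x : 'cV[R]_n :=
  invmx (gram gamma x) *m (sample_matrix gamma x)^T *m sample_vector f x.

Definition s1 gamma x : R := smallest_eigenvalue (gram gamma x).

(* The inverse is that of [\bar R], for which [0^-1 = +oo]: a sample with
   [s1 = 0] counts as an infinite value. For [q = r%:E] the integrand is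
   [s1 ^ (- r / 2)]. Only [1 <= q] is meaningful. *)
Definition K {d' : measure_display} {T : measurableType d'}
    (P : probability T R) gamma (X : 'I_m -> {RV P >-> Omega})
    (q : \bar R) : \bar R :=
  match q with
  | r%:E =>
      ((\int[P]_w ((s1 gamma (X^~ w))%:E^-1 `^ (r / 2))) `^ (2 / r))%E
  | _ => ('N[P]_+oo[(fun w => (s1 gamma (X^~ w))%:E^-1)])%E
  end.

End LeastSquares.

(* Main.v *)
Require Import Defs.
From HB Require Import structures.
From mathcomp Require Import all_boot all_order all_algebra.
From mathcomp Require Import all_classical all_reals all_analysis.
From mathcomp Require Import measurable_realfun ess_sup_inf.
From mathcomp Require Import ring lra.

Set Implicit Arguments.
Unset Strict Implicit.
Unset Printing Implicit Defensive.
Import Order.TTheory GRing.Theory Num.Theory.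
Import numFieldNormedType.Exports.

Local Open Scope classical_set_scope.
Local Open Scope ring_scope.

(** Write G for the Gram matrix of the sample matrix S = Gamma(X), and
    rho = (rho(a)(X_1), ..., rho(a)(X_m)). Where G is invertible,
    F(X) = S a + rho gives the error formula beta - a = N rho with
    N = G^-1 S^T. Since N N^T = G^-1, each entry of the j-th row of N is in
    absolute value at
    most sqrt((G^-1)_jj), hence

      |beta - a|_2 <= sqrt(tr G^-1) * sum_i |rho(a)(X_i)|
                    = sqrt(n) * h * sum_i |rho(a)(X_i)|,

    where h = sqrt(tr G^-1 / n) ([least_squares_error_le]). The diagonal
    entries of G^-1 are at most 1 / s_1, because s_1 is the minimum of the
    Rayleigh quotient of G; so h <= s_1^(-1/2) ([sqr_inverse_scale_le]), and
    the L^q norm of h is at most K_q^(1/2) ([Lnorm_inverse_scale_le]).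
    Hoelder's inequality bounds the expectation of each h |rho(a)(X_i)| by
    K_q^(1/2) |rho(a)|_p, as X_i has law mu, and summing the m <= C n terms
    yields the constant C n sqrt(n) K_q^(1/2).

    Working with h rather than with s_1^(-1/2) is a matter of measurability:
    h is a rational expression in the entries of S followed by a square root,
    hence visibly measurable, which s_1, defined through eigenvalues, is not.
    The integral of s_1^(-q/2) enters as an upper bound only, and comparing it
    with that of h^q uses nothing but monotonicity, which holds for arbitrary
    nonnegative functions because the integral is a supremum over the simple
    functions below the integrand ([ae_ge0_le_integral_outer]).

    That s_1 is the minimum of the Rayleigh quotient is the part of the
    spectral theorem that the argument rests on ([psd_min_eigenvalue]): the
    largest c such that G - c I is positive semidefinite is an eigenvalue,
    since otherwise G - c I would be positive semidefinite and invertible, hence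
    bounded below by some e I with e > 0, and c could be increased. *)

(** * Positive semidefinite matrices and the least eigenvalue *)

Section QuadraticForms.
Context {R : realType}.

Definition bilin n (A : 'M[R]_n) (u v : 'rV[R]_n) : R := (u *m A *m v^T) 0 0.

Definition psd n (A : 'M[R]_n) : Prop := forall v, 0 <= bilin A v v.

Lemma bilinE n (A : 'M[R]_n) u v :
  bilin A u v = \sum_j \sum_i u 0 i * A i j * v 0 j.
Proof.
rewrite /bilin mxE; apply: eq_bigr => j _.
by rewrite !mxE mulr_suml.
Qed.

Lemma bilinBl n (A B : 'M[R]_n) u v :
  bilin (A - B) u v = bilin A u v - bilin B u v.
Proof. by rewrite /bilin mulmxBr mulmxBl !mxE. Qed.

Lemma bilin_scalar n (c : R) (u v : 'rV[R]_n) :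
  bilin c%:M u v = c * bilin 1%:M u v.
Proof. by rewrite /bilin mulmx1 mul_mx_scalar -scalemxAl mxE. Qed.

Lemma bilin1E n (v : 'rV[R]_n) : bilin 1%:M v v = \sum_i v 0 i ^+ 2.
Proof.
by rewrite /bilin mulmx1 mxE; apply: eq_bigr => i _; rewrite mxE expr2.
Qed.

Lemma psd1 n : psd (1%:M : 'M[R]_n).
Proof. by move=> v; rewrite bilin1E sumr_ge0// => i _; rewrite sqr_ge0. Qed.

Lemma sqr_coord_le n (v : 'rV[R]_n) i : v 0 i ^+ 2 <= bilin 1%:M v v.
Proof.
rewrite bilin1E (bigD1 i)//= lerDl sumr_ge0// => j _; exact: sqr_ge0.
Qed.

Lemma psd_gram m n (S : 'M[R]_(m, n)) : psd (S^T *m S).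
Proof.
move=> v; have -> : bilin (S^T *m S) v v = bilin 1%:M (v *m S^T) (v *m S^T).
  by rewrite /bilin mulmx1 trmx_mul trmxK !mulmxA.
exact: psd1.
Qed.

(** Every entry of [A] contributes at most [`|A i j|] times the squared length
    of [v], since a product of two coordinates is at most that length. *)
Lemma bilin_bounded n (A : 'M[R]_n) :
  exists2 M, 0 < M & forall v, bilin A v v <= M * bilin 1%:M v v.
Proof.
exists (1 + \sum_j \sum_i `|A i j|) => [|v].
  by rewrite ltr_pwDl// sumr_ge0// => j _; rewrite sumr_ge0.
apply: (@le_trans _ _ ((\sum_j \sum_i `|A i j|) * bilin 1%:M v v)); last first.
  by rewrite ler_wpM2r ?psd1// lerDr ler01.
rewrite bilinE mulr_suml ler_sum// => j _; rewrite mulr_suml ler_sum// => i _.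
have si := sqr_coord_le v i; have sj := sqr_coord_le v j.
rewrite (le_trans (ler_norm _))// mulrAC mulrC !normrM.
apply: ler_wpM2l => //.
rewrite -(real_normK (num_real (v 0 i))) in si.
rewrite -(real_normK (num_real (v 0 j))) in sj.
nra.
Qed.

(** With M a bound for the form of B^-1, evaluate the form of B at
    v - M^-1 v B^-1. Its expansion is
    B(v, v) - 2 M^-1 |v|^2 + M^-2 B^-1(v, v), which is nonnegative and at most
    B(v, v) - M^-1 |v|^2. *)
Lemma psd_unit_gap n (B : 'M[R]_n) : B^T = B -> psd B -> B \in unitmx ->
  exists2 e, 0 < e & forall v, e * bilin 1%:M v v <= bilin B v v.
Proof.
move=> symB psdB unitB.
have [M M0 leM] := bilin_bounded (invmx B).
exists M^-1; first by rewrite invr_gt0.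
move=> v; set t := M^-1.
have symI : (invmx B)^T = invmx B by rewrite trmx_inv symB.
have := psdB (v - t *: (v *m invmx B)).
have -> : bilin B (v - t *: (v *m invmx B)) (v - t *: (v *m invmx B)) =
    bilin B v v - 2 * t * bilin 1%:M v v + t ^+ 2 * bilin (invmx B) v v.
  rewrite /bilin.
  have -> : (v - t *: (v *m invmx B))^T = v^T - t *: (invmx B *m v^T).
    by rewrite linearB linearZ/= trmx_mul symI.
  rewrite !mulmxBl !mulmxBr -!scalemxAl -!scalemxAr mulmxKV// !mulmxA.
  by rewrite mulmxK// mulmx1 !mxE; ring.
have := leM v.
have tM : t * M = 1 by rewrite mulVf// gt_eqF.
have t0 : 0 < t by rewrite invr_gt0.
move=> lev gev.
have : t ^+ 2 * bilin (invmx B) v v <= t * bilin 1%:M v v.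
  apply: (le_trans (ler_wpM2l (sqr_ge0 t) lev)).
  by rewrite mulrA expr2 -(mulrA t t) tM mulr1.
lra.
Qed.

(** The eigenvalue is the supremum of the c for which A - c I is positive
    semidefinite; the previous gap shows that A - c I cannot be invertible at
    this supremum. *)
Lemma psd_min_eigenvalue n (A : 'M[R]_n) : (0 < n)%N -> A^T = A -> psd A ->
  exists2 l, eigenvalue A l & forall v, l * bilin 1%:M v v <= bilin A v v.
Proof.
move=> n0 symA psdA.
pose S : set R := [set c | forall v, c * bilin 1%:M v v <= bilin A v v].
have S0 : S 0 by move=> v; rewrite mul0r.
(* A unit vector, whose Rayleigh quotient bounds the set from above. *)
pose e : 'rV[R]_n := delta_mx 0 (Ordinal n0).
have e1 : bilin 1%:M e e = 1.
  rewrite bilin1E (bigD1 (Ordinal n0))//= mxE !eqxx expr1n big1 ?addr0// => i ne.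
  by rewrite mxE (negPf ne) andbF expr0n.
have ubS : has_ubound S by exists (bilin A e e) => c /(_ e); rewrite e1 mulr1.
have supS : S (sup S).
  move=> v; have := psd1 v; rewrite le_eqVlt => /predU1P[<-|v0].
    by rewrite mulr0.
  rewrite -ler_pdivlMr//; apply: ge_sup; first by exists 0.
  by move=> c /(_ v); rewrite ler_pdivlMr.
exists (sup S) => //; apply: contraT => neig.
have unitB : A - (sup S)%:M \in unitmx.
  rewrite -row_free_unit -kermx_eq0; move: neig.
  by rewrite /eigenvalue/= negbK.
have symB : (A - (sup S)%:M)^T = A - (sup S)%:M.
  by rewrite linearB/= tr_scalar_mx symA.
have psdB : psd (A - (sup S)%:M).
  by move=> v; rewrite bilinBl bilin_scalar subr_ge0.
have [d d0 gap] := psd_unit_gap symB psdB unitB.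
suff : S (sup S + d) by move=> /(ub_le_sup ubS); rewrite gerDl leNgt d0.
move=> v; have := gap v; rewrite bilinBl (bilin_scalar (sup S)) mulrDl.
lra.
Qed.

Lemma eigenvalue_psd_ge0 n (A : 'M[R]_n) l : psd A -> eigenvalue A l -> 0 <= l.
Proof.
move=> psdA /eigenvalueP[v vA v0].
have : 0 <= l * bilin 1%:M v v.
  by have := psdA v; rewrite /bilin vA mulmx1 -scalemxAl mxE.
suff sv : 0 < bilin 1%:M v v by rewrite pmulr_lge0.
rewrite lt_neqAle psd1 andbT eq_sym; apply: contra v0 => /eqP s0.
apply/eqP/rowP => i; rewrite mxE; apply/eqP.
by rewrite -sqrf_eq0 eq_le sqr_ge0 andbT -s0 sqr_coord_le.
Qed.

Lemma smallest_eigenvalue_ge0 n (A : 'M[R]_n) : (0 < n)%N ->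
  A^T = A -> psd A -> 0 <= smallest_eigenvalue A.
Proof.
move=> n0 symA psdA; have [l Al _] := psd_min_eigenvalue n0 symA psdA.
by apply: lb_le_inf; [exists l|move=> x; exact: eigenvalue_psd_ge0].
Qed.

Lemma smallest_eigenvalue_le n (A : 'M[R]_n) v : (0 < n)%N ->
  A^T = A -> psd A ->
  smallest_eigenvalue A * bilin 1%:M v v <= bilin A v v.
Proof.
move=> n0 symA psdA; have [l Al le_l] := psd_min_eigenvalue n0 symA psdA.
apply: le_trans (le_l v); rewrite ler_wpM2r ?psd1//; apply: ge_inf => //.
by exists 0 => x; exact: eigenvalue_psd_ge0.
Qed.

(** The diagonal entry is the value of the form of [A] at the j-th row of its
    inverse. *)
Lemma invmx_diag_ge0 n (A : 'M[R]_n) j :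
  A^T = A -> psd A -> A \in unitmx -> 0 <= invmx A j j.
Proof.
move=> symA psdA unitA; have := psdA (row j (invmx A)).
rewrite /bilin -row_mul mulVmx// tr_row trmx_inv symA.
by rewrite -row_mul mul1mx !mxE.
Qed.

(** Let v be the j-th row of A^-1 and x its j-th coordinate. Then A(v, v) = x
    and |v|^2 >= x^2, so that the Rayleigh bound reads s x^2 <= x. *)
Lemma invmx_diag_le n (A : 'M[R]_n) j :
  A^T = A -> psd A -> A \in unitmx ->
  smallest_eigenvalue A * invmx A j j <= 1.
Proof.
move=> symA psdA unitA.
have n0 : (0 < n)%N by case: (n) j => [[]|].
have := smallest_eigenvalue_le (row j (invmx A)) n0 symA psdA.
have -> : bilin A (row j (invmx A)) (row j (invmx A)) = invmx A j j.
  rewrite /bilin -row_mul mulVmx// tr_row trmx_inv symA.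
  by rewrite -row_mul mul1mx !mxE.
have := sqr_coord_le (row j (invmx A)) j; rewrite mxE => sq le.
have s0 := smallest_eigenvalue_ge0 n0 symA psdA.
have := invmx_diag_ge0 j symA psdA unitA; rewrite le_eqVlt => /predU1P[<-|i0].
  by rewrite mulr0.
rewrite -(ler_pM2r i0) mul1r -mulrA -expr2.
exact: le_trans (ler_wpM2l s0 sq) le.
Qed.

End QuadraticForms.

(** * The error of least squares at a fixed sample *)

Section LeastSquaresError.
Context {R : realType} {d : measure_display} {Omega : measurableType d}.
Context {n m : nat}.
Implicit Types (f : Omega -> R) (gamma : 'I_n -> Omega -> R) (a : 'cV[R]_n).
Implicit Types x : 'I_m -> Omega.

Lemma gram_sym gamma x : (gram gamma x)^T = gram gamma x.
Proof. by rewrite /gram trmx_mul trmxK. Qed.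

Lemma gram_psd gamma x : psd (gram gamma x).
Proof. exact: psd_gram. Qed.

(** The product of N = G^-1 S^T and its transpose is G^-1, so the diagonal
    entries of G^-1 are the squared lengths of the rows of N. *)
Lemma sqr_pseudoinverse_le gamma x j i : gram gamma x \in unitmx ->
  (invmx (gram gamma x) *m (sample_matrix gamma x)^T) j i ^+ 2 <=
  invmx (gram gamma x) j j.
Proof.
move=> unitG; set N := _ *m _.
have -> : invmx (gram gamma x) = N *m N^T.
  rewrite /N trmx_mul trmxK trmx_inv gram_sym.
  by rewrite mulmxA -(mulmxA (invmx _)) -/(gram _ _) mulVmx// mul1mx.
have sqN k : N j k * N^T k j = N j k ^+ 2 by rewrite [N^T k j]mxE.
rewrite [leRHS]mxE (bigD1 i)//= sqN lerDl sumr_ge0// => k _.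
by rewrite sqN sqr_ge0.
Qed.

Lemma least_squares_error f gamma a x : gram gamma x \in unitmx ->
  least_squares f gamma x - a =
  invmx (gram gamma x) *m (sample_matrix gamma x)^T *m
    (\col_i residue f gamma a (x i)).
Proof.
move=> unitG.
have -> : \col_i residue f gamma a (x i) =
    sample_vector f x - sample_matrix gamma x *m a.
  apply/colP => i; rewrite !mxE; congr (_ - _).
  by apply: eq_bigr => j _; rewrite !mxE mulrC.
rewrite mulmxBr /least_squares; congr (_ - _).
by rewrite !mulmxA -(mulmxA (invmx _)) -/(gram _ _) mulVmx// mul1mx.
Qed.

Lemma least_squares_error_le f gamma a x : gram gamma x \in unitmx ->
  euclidean_norm (least_squares f gamma x - a) <=
  Num.sqrt (\tr (invmx (gram gamma x))) * \sum_i `|residue f gamma a (x i)|.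
Proof.
move=> unitG; rewrite least_squares_error//.
set N := invmx _ *m _; set Ginv := invmx _.
have G0 j : 0 <= Ginv j j.
  by apply: invmx_diag_ge0; [exact: gram_sym|exact: gram_psd|].
set S := \sum_i _.
have S0 : 0 <= S by apply: sumr_ge0.
rewrite -(ger0_norm S0) -sqrtr_sqr -sqrtrM ?sumr_ge0//.
rewrite ler_wsqrtr// /mxtrace mulr_suml ler_sum// => j _.
have -> : Ginv j j = Num.sqrt (Ginv j j) ^+ 2 by rewrite sqr_sqrtr.
rewrite -exprMn -[leLHS]real_normK ?num_real// ler_sqr ?nnegrE ?mulr_ge0//.
rewrite mxE (le_trans (ler_norm_sum _ _ _))// mulr_sumr ler_sum// => i _.
rewrite normrM [(\col_i _) i 0]mxE ler_wpM2r// -sqrtr_sqr ler_wsqrtr//.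
exact: sqr_pseudoinverse_le.
Qed.

(** This is sqrt(tr G^-1 / n) where G is invertible, and 0 elsewhere. Cramer's
    formula replaces [invmx], whose case distinction on invertibility would
    complicate the proof of measurability. *)
Definition inverse_scale gamma x : R :=
  Num.sqrt ((\det (gram gamma x))^-1 * \tr (\adj (gram gamma x)) / n%:R).

Lemma inverse_scaleE gamma x : gram gamma x \in unitmx ->
  inverse_scale gamma x = Num.sqrt (\tr (invmx (gram gamma x)) / n%:R).
Proof. by move=> unitG; rewrite /invmx unitG mxtraceZ. Qed.

(** It holds at every sample: where G is singular the left-hand side is 0, and
    where [s1] vanishes the right-hand side is infinite. *)
Lemma sqr_inverse_scale_le gamma x : (0 < n)%N ->
  ((inverse_scale gamma x ^+ 2)%:E <= (s1 gamma x)%:E^-1)%E.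
Proof.
move=> n0.
have s0 : 0 <= s1 gamma x.
  by apply: smallest_eigenvalue_ge0 => //; [exact: gram_sym|exact: gram_psd].
have [unitG|] := boolP (gram gamma x \in unitmx); last first.
  rewrite unitmxE unitfE negbK /inverse_scale => /eqP ->.
  by rewrite invr0 !mul0r sqrtr0 expr0n/= inve_ge0 lee_fin.
rewrite inver; case: eqP => [_|/eqP sN0]; first by rewrite leey.
have s_gt0 : 0 < s1 gamma x by rewrite lt_neqAle eq_sym sN0.
have Gd j : 0 <= invmx (gram gamma x) j j.
  by apply: invmx_diag_ge0; [exact: gram_sym|exact: gram_psd|].
rewrite lee_fin inverse_scaleE// sqr_sqrtr ?divr_ge0 ?sumr_ge0//.
rewrite ler_pdivrMr ?ltr0n// -[X in _ * X%:R](card_ord n) -sum1_card natr_sum.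
rewrite mulr_sumr ler_sum// => j _; rewrite mulr1.
rewrite -[leRHS]mul1r ler_pdivlMr// mulrC.
by apply: invmx_diag_le; [exact: gram_sym|exact: gram_psd|].
Qed.

End LeastSquaresError.

(** * Measurability of the scale *)

Section Measurability.
Context {R : realType} {d : measure_display} {T : measurableType d}.

Lemma measurable_fun_inv (f : T -> R) :
  measurable_fun setT f -> measurable_fun setT (fun w => (f w)^-1).
Proof.
move=> mf.
(* Powers with a real exponent are inverses on nonnegative arguments only. *)
have -> : (fun w => (f w)^-1) = (fun w => f w * (f w ^+ 2) `^ (-1)).
  apply/funext => w; rewrite powR_inv1 ?sqr_ge0//.
  have [->|f0] := eqVneq (f w) 0; first by rewrite invr0 mul0r.
  by rewrite expr2 invfM mulrA divff// mul1r.
apply: measurable_funM => //.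
by apply: (measurableT_comp (measurable_powR _)); exact: measurable_funX.
Qed.

Lemma measurable_fun_det n (A : T -> 'M[R]_n) :
  (forall i j, measurable_fun setT (fun w => A w i j)) ->
  measurable_fun setT (fun w => \det (A w)).
Proof.
move=> mA; apply: measurable_sum => s; apply: measurable_funM => //.
apply: measurable_prod => i _; exact: mA.
Qed.

Lemma measurable_fun_adj n (A : T -> 'M[R]_n) i j :
  (forall i j, measurable_fun setT (fun w => A w i j)) ->
  measurable_fun setT (fun w => (\adj (A w)) i j).
Proof.
move=> mA.
have -> : (fun w => (\adj (A w)) i j) =
    (fun w => (-1) ^+ (j + i) * \det (row' j (col' i (A w)))).
  by apply/funext => w; rewrite mxE.
apply: measurable_funM => //; apply: measurable_fun_det => k l.
under eq_fun do rewrite !mxE.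
exact: mA.
Qed.

Lemma measurable_inverse_scale d' (Omega : measurableType d') n m
    (gamma : 'I_n -> {mfun Omega >-> R}) (X : 'I_m -> {mfun T >-> Omega}) :
  measurable_fun setT (fun w => inverse_scale gamma (X^~ w)).
Proof.
have mG i j : measurable_fun setT (fun w => gram gamma (X^~ w) i j).
  under eq_fun do rewrite mxE.
  apply: measurable_sum => k; under eq_fun do rewrite !mxE.
  apply: measurable_funM; exact: measurableT_comp.
have msqrt : measurable_fun setT (@Num.sqrt R).
  by apply: continuous_measurable_fun; exact: sqrt_continuous.
apply: (measurableT_comp msqrt).
apply: measurable_funM => //; apply: measurable_funM.
  by apply: measurable_fun_inv; apply: measurable_fun_det; exact: mG.
apply: measurable_sum => i; apply: measurable_fun_adj; exact: mG.
Qed.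

End Measurability.

(** * Integrals and Lp norms *)

Section LpNorms.
Context {R : realType} {d : measure_display} {T : measurableType d}.
Local Open Scope ereal_scope.
Import HBNNSimple.

(** A simple function below [f], cut off to 0 on the exceptional null set, is
    below [g] and has the same integral; so the comparison holds for arbitrary
    nonnegative functions, and serves where measurability is not known. *)
Lemma ae_ge0_le_integral_outer (mu : {measure set T -> \bar R})
    (f g : T -> \bar R) :
  (forall x, 0 <= f x) -> (forall x, 0 <= g x) ->
  {ae mu, forall x, f x <= g x} ->
  \int[mu]_x f x <= \int[mu]_x g x.
Proof.
move=> f0 g0 [N [mN muN0 fgN]].
rewrite !ge0_integralTE//; apply: ge_ereal_sup => _ [h hf <-].
rewrite -integralT_nnsfun (ge0_negligible_integral mN)//; last 2 first.
  exact/measurable_EFinP.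
  by move=> x _; rewrite lee_fin.
rewrite integral_nnsfun; last exact: measurableD.
apply: ereal_sup_ubound; exists (proj_nnsfun h (measurableD measurableT mN)).
  move=> x; rewrite -mrestrict patchE; case: ifPn => [|_]; last exact: g0.
  rewrite inE => -[_ Nx]; apply: le_trans (hf x) _.
  by apply: contrapT => fg; apply: Nx; apply: fgN.
by rewrite (mrestrict _ (measurableD measurableT mN)).
Qed.

Lemma hoelder1y (P : probability T R) (f g : T -> R) :
  measurable_fun setT f ->
  'N[P]_1[EFin \o (f \* g)%R] <=
    'N[P]_1[EFin \o f] * 'N[P]_+oo[EFin \o g].
Proof.
move=> mf; rewrite !Lnorm1 muleC.
rewrite -ge0_integralZl//; last 2 first.
  by do 2 apply: measurableT_comp => //.
  exact: Lnorm_ge0.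
apply: ae_ge0_le_integral_outer => [x//|x|].
  by rewrite mule_ge0// Lnorm_ge0.
rewrite unlock/= probability_setT lte01.
apply: filterS (ess_sup_ge P (abse \o (EFin \o g))) => x /= gx.
by rewrite normrM EFinM muleC lee_wpmul2r.
Qed.

(** Conjugate exponents are either both finite, or equal to 1 and infinity in
    some order, because the inverse of infinity is 0. *)
Lemma hoelder_conj (P : probability T R) (f g : T -> R) (p q : \bar R) :
  measurable_fun setT f -> measurable_fun setT g ->
  1 <= p -> 1 <= q -> p^-1 + q^-1 = 1 ->
  'N[P]_1[EFin \o (f \* g)%R] <= 'N[P]_p[EFin \o f] * 'N[P]_q[EFin \o g].
Proof.
move=> mf mg; case: p => [r| |//]; case: q => [s| |//].
- rewrite !lee_fin => r1 s1.
  have r0 : (0 < r)%R by apply: lt_le_trans r1.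
  have s0 : (0 < s)%R by apply: lt_le_trans s1.
  rewrite !inver (gt_eqF r0) (gt_eqF s0) -EFinD => -[rs].
  exact: hoelder.
- move=> _ _; rewrite invey adde0 => /eqP; rewrite inve_eq1 => /eqP ->.
  exact: hoelder1y.
- move=> _ _; rewrite invey add0e => /eqP; rewrite inve_eq1 => /eqP ->.
  rewrite muleC (_ : f \* g = g \* f)%R; first exact: hoelder1y.
  by apply/funext => x /=; rewrite mulrC.
- by move=> _ _; rewrite invey adde0 => /eqP; rewrite eqe eq_sym oner_eq0.
Qed.

Lemma Lnorm_comp_distribution d' (Omega : measurableType d')
    (mu : probability Omega R) (P : probability T R) (X : {RV P >-> Omega})
    (g : Omega -> R) (p : \bar R) :
  (forall A, measurable A -> distribution P X A = mu A) ->
  measurable_fun setT g -> 1 <= p ->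
  'N[P]_p[EFin \o (g \o X)] = 'N[mu]_p[EFin \o g].
Proof.
move=> Xmu mg.
have mEg : measurable_fun setT (EFin \o g) by exact/measurable_EFinP.
have mag := measurableT_comp (@abse_measurable R setT) mEg.
rewrite unlock; case: p => [r _| _|//].
- congr (_ `^ _).
  have mgr : measurable_fun setT (fun y => `|(g y)%:E| `^ r).
    apply: (measurableT_comp (measurable_poweR _)).
    exact: mag.
  rewrite -(@ge0_integral_distribution _ _ _ _ _ P X (fun y => `|(g y)%:E| `^ r))//.
    by apply: eq_measure_integral => A mA _; exact: Xmu.
  by move=> y; exact: poweR_ge0.
- rewrite /= !probability_setT lte01.
  rewrite !ess_supEmu0//; last first.
    apply: (measurableT_comp (@abse_measurable R setT)).
    by apply/measurable_EFinP; exact: measurableT_comp.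
  congr ereal_inf; apply/seteqP; split => y /=.
    by rewrite -Xmu// -[X in measurable X]setTI; apply: mag => //;
       exact: emeasurable_itv.
  by rewrite -Xmu// -[X in measurable X]setTI; apply: mag => //;
       exact: emeasurable_itv.
Qed.

End LpNorms.

(** * The expected error *)

Section ExpectedError.
Context {R : realType}.
Local Open Scope ereal_scope.

Lemma Lnorm_inverse_scale_le d d' (Omega : measurableType d)
    (T : measurableType d') (P : probability T R) n m
    (gamma : 'I_n -> {mfun Omega >-> R}) (X : 'I_m -> {RV P >-> Omega})
    (q : \bar R) : (0 < n)%N -> 1 <= q ->
  'N[P]_q[EFin \o (fun w => inverse_scale gamma (X^~ w))] <=
    K gamma X q `^ 2^-1.
Proof.
move=> n0; rewrite unlock; case: q => [r|_|//]; rewrite ?lee_fin.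
- move=> r1; have r0 : (0 < r)%R by apply: lt_le_trans r1.
  rewrite /= -poweRrM (_ : 2 / r / 2 = r^-1)%R; last by field; rewrite gt_eqF.
  apply: gt0_ler_poweR.
  + by rewrite invr_ge0 ltW.
  + by rewrite in_itv/= leey andbT integral_ge0// => w _; rewrite lee_fin powR_ge0.
  + by rewrite in_itv/= leey andbT integral_ge0// => w _; exact: poweR_ge0.
  apply: ae_ge0_le_integral_outer => [w|w|].
  + by rewrite lee_fin powR_ge0.
  + exact: poweR_ge0.
  apply: aeW => w.
  set h := inverse_scale _ _.
  (* The exponent r / 2 on the square turns h^2 <= s_1^-1 into the bound on
     the integrands. *)
  have -> : ((`|h| `^ r)%:E = (h ^+ 2)%:E `^ (r / 2))%E.
    rewrite poweR_EFin mulrC powRrM powR12_sqrt ?sqr_ge0//.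
    by rewrite sqrtr_sqr.
  have le := sqr_inverse_scale_le gamma (X^~ w) n0.
  apply: (gt0_ler_poweR _ _ _ le).
  + by rewrite divr_ge0 ?ltW.
  + by rewrite in_itv/= leey andbT lee_fin sqr_ge0.
  + by rewrite in_itv/= leey andbT; apply: le_trans le; rewrite lee_fin sqr_ge0.
- rewrite /K unlock/= probability_setT lte01.
  set M := ess_sup _ (abse \o (fun w => _^-1)).
  apply/ess_supP; apply: filterS (ess_sup_ge P (abse \o (fun w => (s1 gamma (X^~ w))%:E^-1))).
  rewrite -/M => w /= leM.
  rewrite -(sqrtr_sqr (inverse_scale _ _)) -powR12_sqrt ?sqr_ge0// -poweR_EFin.
  have le := le_trans (sqr_inverse_scale_le gamma (X^~ w) n0) (le_trans (lee_abs _) leM).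
  apply: (gt0_ler_poweR _ _ _ le) => //.
  + by rewrite in_itv/= leey andbT lee_fin sqr_ge0.
  + by rewrite in_itv/= leey andbT; apply: le_trans le; rewrite lee_fin sqr_ge0.
Qed.

End ExpectedError.

Theorem proposition3p2 (R : realType) :
  exists Cst : nat -> R -> R -> R,
  forall (d d' : measure_display)
    (Omega : measurableType d) (mu : probability Omega R)
    (T : measurableType d') (P : probability T R)
    (n m : nat) (C : R) (X : 'I_m -> {RV P >-> Omega})
    (f : {mfun Omega >-> R}) (gamma : 'I_n -> {mfun Omega >-> R})
    (a : 'cV[R]_n) (p q : \bar R),
  (1 <= n)%N -> (1 <= m)%N ->
  iid mu X ->
  {ae P, forall w, gram gamma (X^~ w) \in unitmx} ->
  m%:R <= C * n%:R ->
  (1 <= p)%E -> (1 <= q)%E -> (q^-1 + p^-1 = 1)%E ->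
  residue f gamma a \in Lfun mu p ->
  (K gamma X q < +oo)%E ->
  ('E_P[(fun w => euclidean_norm (least_squares f gamma (X^~ w) - a)%R)] <=
     (Cst n C (fine (K gamma X q)))%:E *
     'N[mu]_p[EFin \o residue f gamma a])%E.
Proof.
exists (fun n C k => C * n%:R * (Num.sqrt n%:R * k `^ 2^-1)).
move=> d d' Omega mu T P n m C X f gamma a p q n0 _ [Xmu _] unitG mCn p1 q1 qp.
move=> _ Kfin.
set rho := residue f gamma a; set Np := Lnorm _ _ _.
pose h w := inverse_scale gamma (X^~ w).
have mrho : measurable_fun setT rho.
  by apply: measurable_funB => //; apply: measurable_sum => j; exact: measurable_funM.
have mh : measurable_fun setT h := measurable_inverse_scale gamma X.
have mrhoX i : measurable_fun setT (rho \o X i) by exact: measurableT_comp.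
have h0 w : 0 <= h w by exact: sqrtr_ge0.
have mhr i : measurable_fun setT (fun w => (`|(h \* (rho \o X i)) w|)%:E).
  by apply/measurable_EFinP; apply: measurableT_comp => //; exact: measurable_funM.
have int_le :
    ('E_P[(fun w => euclidean_norm (least_squares f gamma (X^~ w) - a)%R)] <=
     (Num.sqrt n%:R)%:E * \sum_(i < m) 'N[P]_1[EFin \o (h \* (rho \o X i))%R])%E.
  rewrite unlock; under [in leRHS]eq_bigr do rewrite Lnorm1.
  rewrite -(@ge0_integral_sum _ _ _ P _ measurableT _
    (fun i w => (`|(h \* (rho \o X i)) w|)%:E))//.
  rewrite -ge0_integralZl//; last first.
  - by move=> w _; apply: sume_ge0 => i _; rewrite lee_fin.
  - exact: emeasurable_sum.
  apply: ae_ge0_le_integral_outer => [w|w|].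
  - by rewrite lee_fin sqrtr_ge0.
  - by rewrite mule_ge0 ?lee_fin ?sqrtr_ge0//; apply: sume_ge0 => i _; rewrite lee_fin.
  apply: filterS unitG => w unitG.
  rewrite sumEFin -EFinM lee_fin.
  apply: (le_trans (least_squares_error_le f a unitG)).
  have -> : Num.sqrt (\tr (invmx (gram gamma (X^~ w)))) = Num.sqrt n%:R * h w.
    rewrite /h inverse_scaleE// -sqrtrM ?ler0n// mulrC divfK//.
    by rewrite pnatr_eq0 -lt0n.
  rewrite -mulrA mulr_sumr ler_wpM2l ?sqrtr_ge0// ler_sum// => i _.
  by rewrite normrM ger0_norm.
apply: (le_trans int_le).
set kq := K gamma X q in Kfin *.
have Np0 : (0 <= Np)%E by exact: Lnorm_ge0.
have term_le i :
    ('N[P]_1[EFin \o (h \* (rho \o X i))%R] <= kq `^ 2^-1 * Np)%E.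
  apply: (le_trans (hoelder_conj P mh (mrhoX i) q1 p1 qp)).
  rewrite (Lnorm_comp_distribution (Xmu i) mrho p1) lee_wpmul2r//.
  exact: Lnorm_inverse_scale_le.
have kq0 : (0 <= kq)%E.
  by rewrite /kq; case: (q) q1 => [r||]// _; [exact: poweR_ge0|exact: Lnorm_ge0].
have kqE : kq = (fine kq)%:E by rewrite fineK// ge0_fin_numE.
apply: (@le_trans _ _ ((Num.sqrt n%:R)%:E * (m%:R%:E * (kq `^ 2^-1 * Np)))%E).
  rewrite lee_wpmul2l ?lee_fin ?sqrtr_ge0//.
  apply: (le_trans (lee_sum _ (fun i _ => term_le i))).
  by rewrite sumr_const card_ord mule_natl.
rewrite {1}kqE poweR_EFin !muleA -!EFinM lee_wpmul2r// lee_fin.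
rewrite [leRHS]mulrC mulrAC ler_wpM2l//.
by rewrite mulr_ge0 ?sqrtr_ge0 ?powR_ge0.
Qed.
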